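(* Let $T>0$ and $\sigma>0$. For $n\in2\mathbb{N}$ and an exponentially bounded Borel function $g$ put $\varepsilon_n(0,0):=\mathbb{E}[g(\sigma W^n_T)]-\mathbb{E}[g(\sigma W_T)]$. There exists a function $g\in GBV_{\mathrm{exp}}$ such that $$0<\liminf_{n\to\infty}n^{1/2}\varepsilon_n(0,0)\le\limsup_{n\to\infty}n^{1/2}\varepsilon_n(0,0)<\infty,$$ where $n$ runs through the positive even integers.
   Context: $(W_t)_{t\ge0}$ is a standard Brownian motion. With $(\xi_i)_{i\ge1}$ i.i.d. Rademacher random variables ($\mathbb{P}(\xi_i=\pm1)=1/2$), $W^n_t:=\sqrt{T/n}\,\sum_{i=1}^{2\lceil t/(2T/n)\rceil}\xi_i$, $t\in[0,T]$ (so $W^n_T=\sqrt{T/n}\sum_{i=1}^n\xi_i$). Class $\mathcal{M}$: all set functions $\mu$ from the bounded Borel subsets of $\mathbb{R}$ to $\mathbb{R}$ that can be written as a difference $\mu=\mu^1-\mu^2$ of two measures $\mu^1,\mu^2:\mathcal{B}(\mathbb{R})\to[0,\infty]$ that are finite on compact sets. Each $\mu\in\mathcal{M}$ has a unique minimal decomposition $\mu=\mu^+-\mu^-$ (on bounded Borel sets) with $\mu^+,\mu^-$ mutually singular measures, and $|\mu|:=\mu^++\mu^-$. Class $GBV_{\mathrm{exp}}$: all $g:\mathbb{R}\to\mathbb{R}$ that can be represented as $g(x)=c+\mu([0,x))-\mu([x,0))+\sum_{i\ge1}\alpha_i\mathbf{1}_{\{x_i\}}(x)$, $x\in\mathbb{R}$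 (with $[a,b)=\emptyset$ if $a\ge b$), where $c\in\mathbb{R}$, $\mu\in\mathcal{M}$, $(\alpha_i,x_i)_{i\ge1}\subset\mathbb{R}^2$ is countable with $x_i\ne x_j$ for $i\ne j$, and such that for some $\beta\ge0$, $\int_{\mathbb{R}}e^{-\beta|x|}d|\mu|(x)+\sum_{i\ge1}|\alpha_i|e^{-\beta|x_i|}<\infty$. *)

(* Defs.v *)
From HB Require Import structures.
From mathcomp Require Import all_boot all_order all_algebra.
From mathcomp Require Import all_classical all_reals all_analysis.
Set Implicit Arguments.
Unset Strict Implicit.
Unset Printing Implicit Defensive.
Import Order.TTheory GRing.Theory Num.Theory.
Import numFieldNormedType.Exports.
Local Open Scope classical_set_scope.
Local Open Scope ring_scope.

Definition mutually_independent (R : realType) (d : measure_display)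
    (Omega : measurableType d) (P : probability Omega R)
    (X : nat -> Omega -> R) : Prop :=
  forall (J : seq nat) (B : nat -> set (measurableTypeR R)),
    uniq J -> (forall i, measurable (B i)) ->
    P (\bigcap_(i in [set` J]) (X i @^-1` B i)) =
    (\prod_(i <- J) P (X i @^-1` B i))%E.

Definition iid_rademacher (R : realType) (d : measure_display)
    (Omega : measurableType d) (P : probability Omega R)
    (xi : nat -> {RV P >-> measurableTypeR R}) : Prop :=
  mutually_independent P (fun i => xi i : Omega -> R) /\
  forall i, P (xi i @^-1` [set 1]) = (2^-1)%:E /\
            P (xi i @^-1` [set -1]) = (2^-1)%:E.

(* The process is indexed by all of R, but only times t >= 0 are constrained. *)
Definition standard_brownian_motion (R : realType) (d : measure_display)
    (Omega : measurableType d) (P : probability Omega R)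
    (W : R -> {RV P >-> measurableTypeR R}) : Prop :=
  [/\ {ae P, forall w, W 0 w = 0},
      (forall t : nat -> R, 0 <= t 0%N -> (forall i, t i <= t i.+1) ->
        mutually_independent P (fun i w => W (t i.+1) w - W (t i) w)),
      (forall s t : R, 0 <= s -> s < t ->
        forall A : set (measurableTypeR R), measurable A ->
          P ((fun w => W t w - W s w) @^-1` A) =
          normal_prob 0 (Num.sqrt (t - s)) A) &
      {ae P, forall w,
        {within `[0, +oo[, continuous (fun t : R => W t w : R)}}].

(* The random walk W^n_t; [xi i] stands for the variable of index i + 1. *)
Definition walk (R : realType) (Omega : Type) (T : R)
    (xi : nat -> Omega -> R) (n : nat) (t : R) (w : Omega) : R :=
  Num.sqrt (T / n%:R) *
  \sum_(i < 2 * `|Num.ceil (t / (2 * T / n%:R))|) xi i w.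

Definition finite_on_compacts (R : realType)
    (m : {measure set (measurableTypeR R) -> \bar R}) : Prop :=
  forall K : set R, compact K -> (m K < +oo)%E.

(* Elements of the class M are functions on all of [set R] of which only the
   values on bounded Borel sets are relevant. *)
Definition difference_of (R : realType) (mu : set R -> R)
    (m1 m2 : {measure set (measurableTypeR R) -> \bar R}) : Prop :=
  forall A : set (measurableTypeR R), measurable A -> bounded_set (A : set R) ->
    (mu A)%:E = (m1 A - m2 A)%E.

Definition class_M (R : realType) (mu : set R -> R) : Prop :=
  exists m1 m2 : {measure set (measurableTypeR R) -> \bar R},
    [/\ finite_on_compacts m1, finite_on_compacts m2 & difference_of mu m1 m2].

Definition mutually_singular (R : realType)
    (m1 m2 : {measure set (measurableTypeR R) -> \bar R}) : Prop :=
  exists N : set (measurableTypeR R),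
    [/\ measurable N, m1 N = 0%E & m2 (~` N) = 0%E].

Definition minimal_decomposition (R : realType) (mu : set R -> R)
    (mup mum : {measure set (measurableTypeR R) -> \bar R}) : Prop :=
  [/\ finite_on_compacts mup, finite_on_compacts mum,
      difference_of mu mup mum & mutually_singular mup mum].

(* A finite family (alpha_i, x_i) is padded by zero weights at further points.
   As the x_i are distinct, the real series below has at most one nonzero
   term. The total variation |mu| is [measure_add mup mum]. *)
Definition GBVexp (R : realType) (g : R -> R) : Prop :=
  exists (c : R) (mu : set R -> R) (alpha x : nat -> R),
    [/\ class_M mu,
        injective x,
        (forall y : R, g y = c + mu `[0, y[%classic - mu `[y, 0[%classic +
           limn (series (fun i => alpha i * \1_[set x i] y))) &
        exists2 beta : R, 0 <= beta &
        exists mup mum : {measure set (measurableTypeR R) -> \bar R},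
          minimal_decomposition mu mup mum /\
          (\int[measure_add mup mum]_y (expR (- beta * `|y|))%:E +
           \sum_(0 <= i <oo) (`|alpha i| * expR (- beta * `|x i|))%:E
             < +oo)%E].

(* epsilon_n(0,0) = E[g(sigma W^n_T)] - E[g(sigma W_T)]; the walk and the
   Brownian motion need not live on the same probability space. *)
Definition eps00 (R : realType) (d d' : measure_display)
    (Omega : measurableType d) (P : probability Omega R)
    (Omega' : measurableType d') (P' : probability Omega' R)
    (W : R -> Omega -> R) (xi : nat -> Omega' -> R)
    (T sigma : R) (g : R -> R) (n : nat) : \bar R :=
  ('E_P'[fun w => (g (sigma * walk T xi n T w))%R] -
   'E_P[fun w => (g (sigma * W T w))%R])%E.

(* Main.v *)
Require Import Defs.
From HB Require Import structures.
From mathcomp Require Import all_boot all_order all_algebra.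
From mathcomp Require Import all_classical all_reals all_analysis.
From mathcomp Require Import measurable_realfun.
From mathcomp Require Import zify ring lra.
Set Implicit Arguments.
Unset Strict Implicit.
Unset Printing Implicit Defensive.
Import Order.TTheory GRing.Theory Num.Theory.
Import numFieldNormedType.Exports.
Local Open Scope classical_set_scope.
Local Open Scope ring_scope.

(** Changing [g] at a single point does not affect the expectation under the
    Gaussian law, whereas the walk charges its central lattice points with
    masses of order [n^(-1/2)].  The indicator function [g] of {0} isolates
    this effect: the point 0 lies on the lattice of the walk at time [T] for
    every even [n], so with [n = 2m]

      [eps_n(0,0) = P(xi_1 + ... + xi_n = 0) - P(W_T = 0) = 'C(2m, m) / 4^m],

    because the walk takes the value [2k - n] with probability ['C(n, k) / 2^n]
    ([probability_sum_rademacher]) and [W_T] has a density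
    ([brownian_atom0]).

    Stirling's formula would give [sqrt n * eps_n -> sqrt (2 / pi)], but only
    two-sided bounds matter.  The elementary inequalities
    [4^(2m) <= 4m * 'C(2m, m)^2] and [(2m + 1) * 'C(2m, m)^2 <= 4^(2m)], both
    obtained by induction from the ratio of consecutive central binomial
    coefficients, give [1/2 <= (sqrt n * eps_n)^2 <= 1] and hence
    [1/2 <= sqrt n * eps_n <= 1] for all even [n]
    ([sqrtM_central_bin]).  The inferior and superior limits inherit these
    bounds. *)

(** * Central binomial coefficients *)

Lemma central_binS (m : nat) :
  (m.+1 * 'C(2 * m.+1, m.+1) = 2 * (2 * m).+1 * 'C(2 * m, m))%N.
Proof.
have h1 := mul_bin_diag (2 * m.+1) m.
have h2 := mul_bin_down (2 * m).+1 m.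
have e1 : (2 * m.+1).-1 = (2 * m).+1 by lia.
rewrite e1 in h1; rewrite /= in h2.
have e2 : ((2 * m).+1 - m = m.+1)%N by lia.
rewrite e2 in h2.
nia.
Qed.

(** The ratio [4 (m+1) C_(m+1)^2 / (4 m C_m^2)] of consecutive right-hand sides
    is [4 (2m+1)^2 / (m (m+1))], which is at least [16] since
    [(2m+1)^2 >= 4 m (m+1)]. *)
Lemma central_bin_lower (m : nat) :
  (0 < m)%N -> (4 ^ (2 * m) <= 4 * m * 'C(2 * m, m) ^ 2)%N.
Proof.
case: m => // m _; elim: m => [|m IH]; first by [].
have h := central_binS m.+1.
have -> : (4 ^ (2 * m.+2) = 16 * 4 ^ (2 * m.+1))%N.
  by rewrite [in LHS](_ : 2 * m.+2 = (2 * m.+1).+2)%N; [rewrite !expnS; lia|lia].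
move: IH h; set p := (4 ^ _)%N; set b := 'C(2 * m.+1, _); set c := 'C(_, _).
move=> IH h; rewrite -(leq_pmul2l (ltn0Sn m.+1)).
have -> : (m.+2 * (4 * m.+2 * c ^ 2) = 4 * (m.+2 * c) ^ 2)%N by ring.
rewrite h; move: IH; clearbody p b; clear h c => IH; nia.
Qed.

(** The factor [2m + 1] instead of [2m] is what makes the induction close: the
    step is [(2m+1) (2m+3) <= 4 (m+1)^2], whereas [2m] would need
    [(2m+1)^2 <= 4 m (m+1)], which fails. *)
Lemma central_bin_upper (m : nat) :
  ((2 * m).+1 * 'C(2 * m, m) ^ 2 <= 4 ^ (2 * m))%N.
Proof.
elim: m => [|m IH]; first by [].
have h := central_binS m.
have -> : (4 ^ (2 * m.+1) = 16 * 4 ^ (2 * m))%N.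
  by rewrite [in LHS](_ : 2 * m.+1 = (2 * m).+2)%N; [rewrite !expnS; lia|lia].
move: IH h; set p := (4 ^ _)%N; set b := 'C(2 * m, _); set c := 'C(_, _).
move=> IH h; rewrite -(leq_pmul2l (ltn0Sn m)) -(leq_pmul2l (ltn0Sn m)).
have -> : (m.+1 * (m.+1 * ((2 * m.+1).+1 * c ^ 2)) =
           (2 * m.+1).+1 * (m.+1 * c) ^ 2)%N by ring.
rewrite h; move: IH; clearbody p b; clear h c => IH.
apply: leq_trans (_ : 16 * m.+1 ^ 2 * ((2 * m).+1 * b ^ 2) <= _)%N; last nia.
have : ((2 * m.+1).+1 * (2 * m).+1 <= 4 * m.+1 ^ 2)%N by nia.
move=> /(leq_mul (leqnn (4 * ((2 * m).+1 * b ^ 2)))); apply: etrans.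
by congr (_ <= _)%N; ring.
Qed.

Lemma sqrtM_central_bin (R : realType) (m : nat) : (0 < m)%N ->
  2^-1 <= Num.sqrt ((2 * m)%:R : R) * ('C(2 * m, m)%:R * 2 ^- (2 * m)) <= 1.
Proof.
move=> m_gt0; set v := (X in _ <= X <= _).
have p_gt0 : 0 < (4 ^ (2 * m))%:R :> R by rewrite ltr0n expn_gt0.
have v2 : v ^+ 2 = ((2 * m) * 'C(2 * m, m) ^ 2)%:R / (4 ^ (2 * m))%:R.
  rewrite /v !exprMn sqr_sqrtr ?ler0n// mulrA; congr (_ * _).
    by rewrite -natrX -natrM.
  by rewrite exprVn -exprM (mulnC _ 2%N) exprM -!natrX.
have v_ge0 : 0 <= v by rewrite !mulr_ge0 ?invr_ge0 ?exprn_ge0.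
apply/andP; split.
(* The squared bound is not sharp: [v^2 >= 1/2] gives [v >= 1/2] as
     [1/4 <= 1/2]. *)
- suff : 2^-1 <= v ^+ 2 by move=> ?; nra.
  rewrite v2 ler_pdivlMr// ler_pdivrMl// -natrM ler_nat.
  by have := central_bin_lower m_gt0; nia.
- suff : v ^+ 2 <= 1 by move=> ?; nra.
  rewrite v2 ler_pdivrMr// mul1r ler_nat.
  by have := central_bin_upper m; nia.
Qed.

(** * The law of the simple random walk *)

Section RademacherSum.
Context (R : realType) (d : measure_display) (Omega : measurableType d).
Context (P : probability Omega R) (xi : nat -> {RV P >-> measurableTypeR R}).

Definition sign_of (n : nat) (A : {set 'I_n}) (i : nat) : R :=
  if i \in [seq val j | j in A] then 1 else -1.

(** The cylinder event on which the first [n] signs are those coded by [A], the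
    set of the indices carrying the sign +1. *)
Definition sign_event (n : nat) (A : {set 'I_n}) : set Omega :=
  \bigcap_(i in [set` iota 0 n]) (xi i @^-1` [set sign_of A i]).

Lemma sign_of_ord (n : nat) (A : {set 'I_n}) (i : 'I_n) :
  sign_of A i = if i \in A then 1 else -1.
Proof. by rewrite /sign_of fintype.mem_image //; exact: val_inj. Qed.

Lemma sign_eventE (n : nat) (A : {set 'I_n}) (w : Omega) (i : 'I_n) :
  sign_event A w -> xi i w = if i \in A then 1 else -1.
Proof. by move=> /(_ i); rewrite -sign_of_ord; apply; rewrite /= mem_iota /=. Qed.

Lemma measurable_sign_event (n : nat) (A : {set 'I_n}) :
  measurable (sign_event A).
Proof.
by apply: fin_bigcap_measurable.
Qed.

Lemma sign_event_inj (n : nat) (A B : {set 'I_n}) (w : Omega) :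
  sign_event A w -> sign_event B w -> A = B.
Proof.
move=> wA wB; apply/setP => i.
have := sign_eventE i wA; rewrite (sign_eventE i wB).
by case: (i \in A); case: (i \in B) => // ?; lra.
Qed.

Lemma sum_sign_event (n : nat) (A : {set 'I_n}) (w : Omega) :
  sign_event A w -> \sum_(i < n) xi i w = (2 * #|A|)%:R - n%:R.
Proof.
move=> wA; under eq_bigr do rewrite (sign_eventE _ wA).
rewrite (eq_bigr (fun i => (i \in A)%:R *+ 2 - 1 : R)); last first.
  by move=> i _; case: (i \in A); rewrite /= ?mul0rn ?mulr0n; ring.
rewrite sumrB sumr_const card_ord sumrMnl; congr (_ - _).
have -> : \sum_i (i \in A)%:R = #|A|%:R :> R.
  rewrite -sumr_const [RHS]big_mkcond.
  by apply: eq_bigr => i _; case: (i \in A).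
by rewrite natrM mulr_natl.
Qed.

Lemma measurable_sum_RV (n : nat) :
  measurable_fun setT (fun w => \sum_(i < n) (xi i w : R)).
Proof. by apply: measurable_sum => i; exact: (measurable_funPT (xi i)). Qed.

Lemma probability_sign_event (n : nat) (A : {set 'I_n}) :
  iid_rademacher xi ->
  P (sign_event A) = (2 ^- n)%:E.
Proof.
move=> [indep half].
rewrite [LHS](indep (iota 0 n) (fun i => [set sign_of A i])) ?iota_uniq//.
rewrite (eq_bigr (fun=> (2^-1 : R)%:E)) => [|i _]; last first.
  by rewrite /sign_of; have [? ?] := half i; case: ifP.
by rewrite prodEFin big_const_seq count_predT size_iota iter_mulr_1 exprVn.
Qed.

Lemma probability_sign_events (n : nat) (Q : {set {set 'I_n}}) :
  iid_rademacher xi ->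
  P (\bigcup_(A in [set` Q]) sign_event A) = (#|Q|%:R * 2 ^- n)%:E.
Proof.
move=> xi_rademacher.
rewrite measure_fin_bigcup//; last 2 first.
- by move=> A B _ _ [w [wA wB]]; exact: sign_event_inj wA wB.
- by move=> A _; exact: measurable_sign_event.
rewrite (eq_fsbigr (fun=> (2 ^- n : R)%:E)) => [|A _]; last first.
  exact: probability_sign_event.
have -> : (\sum_(A \in [set` Q]) (2 ^- n : R)%:E =
          \sum_(A in Q) (2 ^- n : R)%:E)%E.
  apply/esym/bigfs; first exact: index_enum_uniq.
  by move=> A _; rewrite mem_index_enum.
by rewrite sumEFin sumr_const mulr_natl.
Qed.

(** On each cylinder event the sum is determined, so the event [E] contains all
    cylinders with [k] plus signs and its complement contains all the others.
    Bounding both from below pins down the probability of [E]; in this way the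
    null set where some [xi i] is neither 1 nor -1 never has to be named. *)
Lemma probability_sum_rademacher (n k : nat) :
  iid_rademacher xi ->
  P [set w | \sum_(i < n) xi i w = (2 * k)%:R - n%:R] =
  ('C(n, k)%:R * 2 ^- n)%:E.
Proof.
move=> xi_rademacher; set E := [set w | _].
pose Q := [set A : {set 'I_n} | #|A| == k]%SET.
have mE : measurable E.
  rewrite -[E]setTI.
  exact: (measurable_sum_RV n) measurableT _ (measurable_set1 _).
have cQ : #|Q| = 'C(n, k) by rewrite card_draws card_ord.
have cQC : (#|~: Q| + #|Q| = 2 ^ n)%N.
  by rewrite addnC cardsC -cardsT -powersetT card_powerset cardsT card_ord.
have mU (S : {set {set 'I_n}}) :
    measurable (\bigcup_(A in [set` S]) sign_event A).
  by apply: fin_bigcup_measurable => // A _; exact: measurable_sign_event.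
have lowerE : (('C(n, k)%:R * 2 ^- n)%:E <= P E)%E.
  rewrite -cQ -(probability_sign_events _ xi_rademacher) le_measure ?inE//.
  move=> w [A]; rewrite /= inE => /eqP Ak wA.
  by rewrite /E /= (sum_sign_event wA) Ak.
have lowerC : ((#|~: Q|%:R * 2 ^- n)%:E <= P (~` E))%E.
  rewrite -(probability_sign_events _ xi_rademacher) le_measure ?inE//; first exact: measurableC.
  move=> w [A]; rewrite /= !inE => /eqP Ak wA; rewrite /E /=.
  by rewrite (sum_sign_event wA) => /addIr /eqP; rewrite eqr_nat eqn_mul2l => /eqP.
apply/eqP; rewrite eq_le lowerE andbT.
move: lowerC; rewrite probability_setC//.
have -> : #|~: Q|%:R * 2 ^- n = 1 - 'C(n, k)%:R * 2 ^- n :> R.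
  have -> : #|~: Q| = (2 ^ n - 'C(n, k))%N by lia.
  rewrite natrB; last by lia.
  by rewrite mulrBl natrX divff// expf_neq0.
by rewrite -(fineK (fin_num_measure P E mE)) -EFinB !lee_fin; lra.
Qed.

End RademacherSum.

Lemma walk_terminal (R : realType) (Omega : Type) (T : R)
    (xi : nat -> Omega -> R) (m : nat) (w : Omega) : 0 < T -> (0 < m)%N ->
  walk T xi (2 * m) T w =
  Num.sqrt (T / (2 * m)%:R) * \sum_(i < 2 * m) xi i w.
Proof.
move=> T_gt0 m_gt0; rewrite /walk.
have -> : T / (2 * T / (2 * m)%:R) = m%:R.
  have m0 : m%:R != 0 :> R by rewrite pnatr_eq0 -lt0n.
  by rewrite natrM; field; rewrite m0 gt_eqF.
by rewrite -[m%:R]/(m%:Z%:~R) intrKceil absz_nat.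
Qed.

(** * Brownian motion has no atom at zero *)

(** Only the increment [W t - W 0] is known to be Gaussian; almost surely it
    vanishes when [W t] does, since [W 0 = 0] almost surely. *)
Lemma brownian_atom0 (R : realType) (d : measure_display)
    (Omega : measurableType d) (P : probability Omega R)
    (W : R -> {RV P >-> measurableTypeR R}) (t : R) :
  standard_brownian_motion W -> 0 < t -> P (W t @^-1` [set 0]) = 0.
Proof.
move=> [W0 _ Wgauss _] t_gt0.
have mset0 : measurable ([set 0] : set (measurableTypeR R)).
  exact: measurable_set1.
apply: measure_negligible; first exact: measurable_funPTI.
have mincr : measurable_fun setT (fun w => (W t w : R) - W 0 w).
  by apply: measurable_funB; exact: (measurable_funPT (W _)).
have inc0 : P.-negligible ((fun w => W t w - W 0 w) @^-1` [set 0]).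
  apply/negligibleP.
    by rewrite -[X in measurable X]setTI; exact: mincr.
  apply: etrans (Wgauss 0 t (lexx 0) t_gt0 _ mset0) _.
  apply: (iffLR (null_content_dominatesP _ _)
    (normal_prob_dominates 0 (Num.sqrt (t - 0)))) => //.
  exact: lebesgue_measure_set1.
apply: negligibleS (negligibleU inc0 W0) => w /= Wt.
by have [W0w|?] := eqVneq (W 0 w) 0; [left; rewrite W0w Wt subrr|right; exact/eqP].
Qed.

(** * Indicator functions of points *)

(** The indicator has no part of locally bounded variation beyond a single
    weight 1 at [a]; the points [a + i] with [i > 0] carry weight 0 and only
    complete the family to an injective sequence. *)
Lemma indic1_GBVexp (R : realType) (a : R) : GBVexp (\1_[set a] : R -> R).
Proof.
have fin0 : finite_on_compacts (mzero : {measure set (measurableTypeR R) -> \bar R}).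
  by move=> K _; rewrite /= /mzero ltry.
have diff0 : difference_of (fun=> 0 : R)
    (mzero : {measure set (measurableTypeR R) -> \bar R}) mzero.
  by move=> A _ _; rewrite /= /mzero sube0.
exists 0, (fun=> 0), (fun i => (i == 0)%:R), (fun i => a + i%:R); split.
- by exists mzero, mzero.
- by move=> i j /addrI/eqP; rewrite eqr_nat => /eqP.
- move=> y; rewrite addr0 subr0 add0r.
  apply/esym/cvg_lim => //.
  (* The partial sums are constant from index 1 on. *)
  rewrite -(cvg_shiftS _); apply: cvg_near_cst; apply: nearW => n /=.
  rewrite /series /= big_nat_recl//= big1 ?mul1r ?addr0// => i _.
  by rewrite mul0r.
- exists 0 => //; exists mzero, mzero; split.
    by split=> //; exists set0; split.
  under eq_integral do rewrite oppr0 mul0r expR0.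
  rewrite ge0_integral_measure_add//.
  rewrite !integral_measure_zero !add0e.
  rewrite nneseries_recl// eseries0 ?adde0 ?ltry//.
  by move=> i i_gt0 _; rewrite (gtn_eqF i_gt0) normr0 mul0r.
Qed.

(** * Bounds on inferior and superior limits *)

Lemma limn_einf_ge (R : realType) (u : nat -> \bar R) (a : \bar R) :
  (forall n, a <= u n)%E -> (a <= limn_einf u)%E.
Proof.
move=> au; rewrite limn_einf_lim; apply: lime_ge; first exact: is_cvg_einfs.
by apply: nearW => n; apply: le_ereal_inf_tmp => _ [k _ <-].
Qed.

Lemma limn_esup_le (R : realType) (u : nat -> \bar R) (a : \bar R) :
  (forall n, u n <= a)%E -> (limn_esup u <= a)%E.
Proof.
move=> ua; rewrite limn_esup_lim; apply: lime_le; first exact: is_cvg_esups.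
by apply: nearW => n; apply: ge_ereal_sup => _ [k _ <-].
Qed.

(** * The error for the indicator function of zero *)

Lemma expectation_indic0_scaled (R : realType) (d : measure_display)
    (Omega : measurableType d) (P : probability Omega R) (c : R)
    (X : Omega -> R) : c != 0 -> measurable_fun setT X ->
  'E_P[fun w => (\1_[set 0] (c * X w) : R)%R]%E = P (X @^-1` [set 0]).
Proof.
move=> c_neq0 mX.
rewrite -expectation_indic; last first.
  by rewrite -[X in measurable X]setTI; exact: mX measurableT _ (measurable_set1 _).
congr expectation; apply/funext => w; rewrite !indicE; congr _%:R.
congr nat_of_bool; apply/idP/idP; rewrite !inE /=.
  by move=> /eqP; rewrite mulf_eq0 (negbTE c_neq0) => /eqP.
by move=> ->; rewrite mulr0.
Qed.

Theorem proposition4p14 (R : realType) (T sigma : R)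
    (T_gt0 : 0 < T) (sigma_gt0 : 0 < sigma)
    (d : measure_display) (Omega : measurableType d) (P : probability Omega R)
    (W : R -> {RV P >-> measurableTypeR R})
    (W_brownian : standard_brownian_motion W)
    (d' : measure_display) (Omega' : measurableType d')
    (P' : probability Omega' R) (xi : nat -> {RV P' >-> measurableTypeR R})
    (xi_rademacher : iid_rademacher xi) :
  exists g : R -> R, GBVexp g /\
    let u (k : nat) : \bar R :=
      let n := (2 * k.+1)%N in
      ((Num.sqrt (n%:R : R))%:E *
       eps00 P P' (fun t => W t : Omega -> R) (fun i => xi i : Omega' -> R)
         T sigma g n)%E in
    [/\ (0 < limn_einf u)%E, (limn_einf u <= limn_esup u)%E
      & (limn_esup u < +oo)%E].
Proof.
exists (\1_[set 0]); split; first exact: indic1_GBVexp.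
move=> u.
have uE k : u k = (Num.sqrt (2 * k.+1)%:R *
    ('C(2 * k.+1, k.+1)%:R * 2 ^- (2 * k.+1)))%:E.
  rewrite /u /eps00 EFinM; congr (_ * _)%E.
  have mW : measurable_fun setT (W T : Omega -> R).
    exact: (measurable_funPT (W T)).
  rewrite (expectation_indic0_scaled _ _ mW) ?gt_eqF// brownian_atom0// sube0.
  under eq_fun do rewrite walk_terminal// mulrA.
  rewrite (expectation_indic0_scaled _ _ (measurable_sum_RV xi _)); last first.
    by rewrite mulf_neq0 ?gt_eqF// sqrtr_gt0 divr_gt0// ltr0n.
  (* The value 0 is [2k - n] for [k = n / 2]. *)
  by rewrite -(probability_sum_rademacher _ _ xi_rademacher) subrr.
have ub k : ((2^-1 : R)%:E <= u k <= 1%:E)%E.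
  by rewrite uE !lee_fin sqrtM_central_bin.
split.
- apply: lt_le_trans (@limn_einf_ge _ _ (2^-1)%:E _).
    by rewrite lte_fin invr_gt0.
  by move=> k; have /andP[] := ub k.
- exact: limn_einf_sup.
- apply: le_lt_trans (@limn_esup_le _ _ 1%:E _) (ltry _).
  by move=> k; have /andP[] := ub k.
Qed.
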